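(* (a) The non-standard real numbers ${}^*\mathbb{R}$ are a totally ordered field. (b) The real numbers $\mathbb{R}$ are a totally ordered subfield of ${}^*\mathbb{R}$.
   Context: $\mathbb{R}_+$ is the set of positive real numbers and $\mathbb{N}=\{1,2,3,\dots\}$. Fix an ultrafilter $\mathcal{U}$ on $\mathbb{R}_+$ such that $(0,\tfrac1n)\in\mathcal{U}$ for all $n\in\mathbb{N}$. A property of $\varepsilon\in\mathbb{R}_+$ holds almost everywhere (a.e.) if the set of $\varepsilon$ for which it holds belongs to $\mathcal{U}$. For nets $(a_\varepsilon),(b_\varepsilon)\in\mathbb{C}^{\mathbb{R}_+}$ write $(a_\varepsilon)\sim(b_\varepsilon)$ if $a_\varepsilon=b_\varepsilon$ a.e.; $\langle a_\varepsilon\rangle$ is the equivalence class of $(a_\varepsilon)$, and ${}^*\mathbb{C}=\mathbb{C}^{\mathbb{R}_+}/\!\sim$ with operations induced pointwise. ${}^*\mathbb{R}=\{\langle a_\varepsilon\rangle\in{}^*\mathbb{C} : a_\varepsilon\in\mathbb{R}\text{ a.e.}\}$. For $\langle a_\varepsilon\rangle,\langle b_\varepsilon\rangle\in{}^*\mathbb{R}$, $\langle a_\varepsilon\rangle<\langle b_\varepsilon\rangle$ means $a_\varepsilon<b_\varepsilon$ a.e. A number $c\in\mathbb{C}$ (in particular $c\in\mathbb{R}$) is identified with the class of the constant net $c_\varepsilon=c$. *)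

(* Defs.v *)
From HB Require Import structures.
From mathcomp Require Import all_boot all_order all_algebra generic_quotient.
From mathcomp Require Import all_classical all_reals.
From mathcomp Require Import filter interval_inference complex.

Set Implicit Arguments.
Unset Strict Implicit.
Unset Printing Implicit Defensive.

Import Order.TTheory GRing.Theory Num.Theory.

Local Open Scope classical_set_scope.
Local Open Scope ring_scope.
Local Open Scope complex_scope.
Local Open Scope quotient_scope.

(* The ultrafilter U lives on the type {posnum R} of positive reals, and a
   property holds almost everywhere when it holds near U.  The constraint that
   U contains every interval ]0, 1/n[ plays no role in the constructions below
   and is not required there. *)

Definition net (R : realType) : Type := {posnum R} -> R[i].

HB.instance Definition _ (R : realType) := Choice.on (net R).

Section NetEquivalence.
Variables (R : realType) (U : set_system {posnum R}) (UU : UltraFilter U).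

Definition net_eqv (a b : net R) : bool := `[< \forall e \near U, a e = b e >].

Let U_filter : Filter U := @ultra_proper _ _ UU.

Lemma net_eqv_refl : reflexive net_eqv.
Proof. by move=> a; apply/asboolP; apply: nearW. Qed.

Lemma net_eqv_sym : symmetric net_eqv.
Proof.
by move=> a b; apply: asbool_equiv_eq; split; apply: filterS => e ->.
Qed.

Lemma net_eqv_trans : transitive net_eqv.
Proof.
move=> b a c /asboolP ab /asboolP bc; apply/asboolP.
by move: ab bc; apply: filterS2 => e -> ->.
Qed.

Definition net_equiv := EquivRel net_eqv net_eqv_refl net_eqv_sym net_eqv_trans.

End NetEquivalence.

Definition starC (R : realType) (U : set_system {posnum R})
  (UU : UltraFilter U) : Type := {eq_quot net_equiv UU}.

HB.instance Definition _ (R : realType) (U : set_system {posnum R})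
  (UU : UltraFilter U) := EqQuotient.on (starC UU).
HB.instance Definition _ (R : realType) (U : set_system {posnum R})
  (UU : UltraFilter U) := Choice.on (starC UU).

Section Star.
Variables (R : realType) (U : set_system {posnum R}) (UU : UltraFilter U).

Let U_filter : Filter U := @ultra_proper _ _ UU.

Definition star_class (a : net R) : starC UU := \pi_(starC UU) a.

(* These three are defined on the representatives selected by [repr];
   star_addE, star_mulE and star_ltE show that the choice is immaterial. *)

Definition star_add (x y : starC UU) : starC UU :=
  star_class (fun e => repr x e + repr y e).

Definition star_mul (x y : starC UU) : starC UU :=
  star_class (fun e => repr x e * repr y e).

(* On R[i], a < b means that a and b have the same imaginary part and
   'Re a < 'Re b; it is the order of the reals when a and b are real. *)
Definition star_lt (x y : starC UU) : Prop :=
  \forall e \near U, repr x e < repr y e.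

Definition star_cst (c : R[i]) : starC UU := star_class (fun=> c).

Definition starR : set (starC UU) :=
  [set star_class a | a in [set a : net R | \forall e \near U, a e \is Num.real]].

Lemma star_classP (a b : net R) :
  star_class a = star_class b <-> \forall e \near U, a e = b e.
Proof.
by split=> [/eqquotP/asboolP|ab] //; apply/eqquotP/asboolP.
Qed.

Lemma repr_star_class (a : net R) :
  \forall e \near U, repr (star_class a) e = a e.
Proof. by apply/star_classP; rewrite /star_class reprK. Qed.

Lemma star_addE (a b : net R) :
  star_add (star_class a) (star_class b) = star_class (fun e => a e + b e).
Proof.
apply/star_classP; move: (repr_star_class a) (repr_star_class b).
by apply: filterS2 => e -> ->.
Qed.

Lemma star_mulE (a b : net R) :
  star_mul (star_class a) (star_class b) = star_class (fun e => a e * b e).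
Proof.
apply/star_classP; move: (repr_star_class a) (repr_star_class b).
by apply: filterS2 => e -> ->.
Qed.

Lemma star_ltE (a b : net R) :
  star_lt (star_class a) (star_class b) <-> \forall e \near U, a e < b e.
Proof.
split; move: (repr_star_class a) (repr_star_class b);
  by apply: filterS3 => e -> ->.
Qed.

Lemma starRE (a : net R) :
  starR (star_class a) <-> \forall e \near U, a e \is Num.real.
Proof.
split=> [[b br /star_classP]|ar]; last by exists a.
by move: br; apply: filterS2 => e br <-.
Qed.

End Star.

Arguments star_cst {R U} UU c.
Arguments starR {R U} UU.

(* Main.v *)
(* The ultraproduct argument: modulo U every element of *R is the class of a
   net of reals, operations and order act on such nets entrywise, and every
   identity valid in R for all e passes to classes.  The axioms that are not
   identities, namely inverses and totality of the order, follow from the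
   maximality of U: a set or its complement belongs to U. *)

From HB Require Import structures.
Require Import Defs.
From mathcomp Require Import all_boot all_order all_algebra.
From mathcomp Require Import all_classical all_reals.
From mathcomp Require Import filter interval_inference complex.

Import Order.TTheory GRing.Theory Num.Theory.
Local Open Scope classical_set_scope.
Local Open Scope ring_scope.
Local Open Scope complex_scope.

(* An alias of the sigma-type underlying starR, so that the instances below are
   not attached to arbitrary sets viewed as types. *)
Definition star_real (R : realType) (U : set_system {posnum R})
  (UU : UltraFilter U) : Type := starR UU.

HB.instance Definition _ (R : realType) (U : set_system {posnum R})
  (UU : UltraFilter U) := Choice.copy (star_real R U UU) (starR UU).

Section StarReal.
Variables (R : realType) (U : set_system {posnum R}) (UU : UltraFilter U).

Let U_proper : ProperFilter U := @ultra_proper _ _ UU.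

Local Notation starR := (star_real R U UU).
Local Notation rnet := ({posnum R} -> R).

(** * Elements of *R as classes of nets of reals *)

Lemma real_net_starR (f : rnet) :
  star_class UU (fun e => (f e)%:C) \in Defs.starR UU.
Proof.
by apply/mem_set/starRE; apply: nearW => e; apply/complex_realP; exists (f e).
Qed.

Definition real_class (f : rnet) : starR :=
  exist (fun x => x \in Defs.starR UU) _ (real_net_starR f).

(** A representative of an element of *R may take non-real values off a set of [U]; the real part
    removes them without changing the class. *)
Definition real_repr (x : starR) : rnet := fun e => complex.Re (repr (\val x) e).

Lemma real_classP (f g : rnet) :
  real_class f = real_class g <-> \forall e \near U, f e = g e.
Proof.
split=> [/(congr1 val)/star_classP|fg].
  by apply: filterS => e; apply: complexI.
by apply/val_inj/star_classP; move: fg; apply: filterS => e ->.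
Qed.

Lemma real_reprK : cancel real_repr real_class.
Proof.
move=> x; apply: val_inj; rewrite /= -[RHS]reprK; apply/star_classP.
have /set_mem := valP x; rewrite -{1}[\val x]reprK => /starRE.
by apply: filterS => e; apply: RRe_real.
Qed.

(** Serves as the eliminator that reduces each axiom below to a statement on real nets. *)
Lemma real_class_ind (P : starR -> Prop) :
  (forall f, P (real_class f)) -> forall x, P x.
Proof. by move=> Pf x; rewrite -[x]real_reprK. Qed.

Lemma real_classK (f : rnet) :
  \forall e \near U, real_repr (real_class f) e = f e.
Proof. by apply/real_classP; rewrite real_reprK. Qed.

(** * Entrywise lifting of operations and relations from R *)

Definition lift1 (op : R -> R) (x : starR) : starR :=
  real_class (fun e => op (real_repr x e)).

Definition lift2 (op : R -> R -> R) (x y : starR) : starR :=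
  real_class (fun e => op (real_repr x e) (real_repr y e)).

Definition lift_rel (r : rel R) : rel starR :=
  fun x y => `[< \forall e \near U, r (real_repr x e) (real_repr y e) >].

Lemma lift1E op f : lift1 op (real_class f) = real_class (fun e => op (f e)).
Proof. by apply/real_classP; have := real_classK f; apply: filterS => e ->. Qed.

Lemma lift2E op f g : lift2 op (real_class f) (real_class g) =
  real_class (fun e => op (f e) (g e)).
Proof.
apply/real_classP; move: (real_classK f) (real_classK g).
by apply: filterS2 => e -> ->.
Qed.

Lemma lift_relE r f g : lift_rel r (real_class f) (real_class g) =
  `[< \forall e \near U, r (f e) (g e) >].
Proof.
apply: asbool_equiv_eq; split; move: (real_classK f) (real_classK g);
  by apply: filterS3 => e -> ->.
Qed.

Local Notation cst r := (real_class (fun=> r)).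

(** * Field structure *)

Lemma lift_addA : associative (lift2 +%R).
Proof.
elim/real_class_ind=> f; elim/real_class_ind=> g; elim/real_class_ind=> h.
by rewrite !lift2E; congr real_class; apply/funext => e; rewrite addrA.
Qed.

Lemma lift_addC : commutative (lift2 +%R).
Proof.
elim/real_class_ind=> f; elim/real_class_ind=> g.
by rewrite !lift2E; congr real_class; apply/funext => e; rewrite addrC.
Qed.

Lemma lift_add0 : left_id (cst 0) (lift2 +%R).
Proof.
elim/real_class_ind=> f.
by rewrite !lift2E; congr real_class; apply/funext => e; rewrite add0r.
Qed.

Lemma lift_addN : left_inverse (cst 0) (lift1 -%R) (lift2 +%R).
Proof.
elim/real_class_ind=> f.
by rewrite lift1E lift2E; congr real_class; apply/funext => e; rewrite addNr.
Qed.

HB.instance Definition _ :=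
  GRing.isZmodule.Build starR lift_addA lift_addC lift_add0 lift_addN.

Lemma lift_mulA : associative (lift2 *%R).
Proof.
elim/real_class_ind=> f; elim/real_class_ind=> g; elim/real_class_ind=> h.
by rewrite !lift2E; congr real_class; apply/funext => e; rewrite mulrA.
Qed.

Lemma lift_mulC : commutative (lift2 *%R).
Proof.
elim/real_class_ind=> f; elim/real_class_ind=> g.
by rewrite !lift2E; congr real_class; apply/funext => e; rewrite mulrC.
Qed.

Lemma lift_mul1 : left_id (cst 1) (lift2 *%R).
Proof.
elim/real_class_ind=> f.
by rewrite !lift2E; congr real_class; apply/funext => e; rewrite mul1r.
Qed.

Lemma lift_mulDl : left_distributive (lift2 *%R) (lift2 +%R).
Proof.
elim/real_class_ind=> f; elim/real_class_ind=> g; elim/real_class_ind=> h.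
by rewrite !lift2E; congr real_class; apply/funext => e; rewrite mulrDl.
Qed.

(** Sets in a proper filter are inhabited, so a constant equation true a.e. is true. *)
Lemma real_class_cst_inj : injective (fun r : R => cst r).
Proof. by move=> r t /real_classP/filter_ex[]. Qed.

Lemma cst1_neq0 : cst 1 != cst 0.
Proof. by apply/eqP => /real_class_cst_inj/eqP; rewrite oner_eq0. Qed.

HB.instance Definition _ := GRing.Zmodule_isComNzRing.Build starR
  lift_mulA lift_mulC lift_mul1 lift_mulDl cst1_neq0.

Lemma lift_mulV x : x != cst 0 -> lift2 *%R (lift1 GRing.inv x) x = cst 1.
Proof.
elim/real_class_ind: x => f /eqP fn0; rewrite lift1E lift2E.
(* Either [f] vanishes a.e., which contradicts [fn0], or it is nonzero a.e.; in the second case the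
   default value of the inverse at zeros of [f] does not affect the class. *)
have [f0|fn] := in_ultra_setVsetC [set e | f e = 0] UU.
  by case: fn0; apply/real_classP.
by apply/real_classP; apply: filterS fn => e /eqP /mulVf.
Qed.

Lemma lift_inv0 : lift1 GRing.inv (cst 0) = cst 0.
Proof. by rewrite lift1E invr0. Qed.

HB.instance Definition _ :=
  GRing.ComNzRing_isField.Build starR lift_mulV lift_inv0.

(** * Total order and absolute value *)

Local Notation le := (lift_rel <=%R).
Local Notation lt := (lift_rel <%R).

(** The order is built from its cone of nonnegative elements, hence the comparisons with [cst 0];
    [lift_sub_ge0] extends them to arbitrary pairs. *)
Lemma lift_le0D x y : le (cst 0) x -> le (cst 0) y -> le (cst 0) (x + y).
Proof.
elim/real_class_ind: x => f; elim/real_class_ind: y => g.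
rewrite [_ + _]lift2E !lift_relE => /asboolP f0 /asboolP g0; apply/asboolP.
by move: f0 g0; apply: filterS2 => e; apply: addr_ge0.
Qed.

Lemma lift_le0M x y : le (cst 0) x -> le (cst 0) y -> le (cst 0) (x * y).
Proof.
elim/real_class_ind: x => f; elim/real_class_ind: y => g.
rewrite [_ * _]lift2E !lift_relE => /asboolP f0 /asboolP g0; apply/asboolP.
by move: f0 g0; apply: filterS2 => e; apply: mulr_ge0.
Qed.

Lemma lift_le0_anti x : le (cst 0) x -> le x (cst 0) -> x = cst 0.
Proof.
elim/real_class_ind: x => f; rewrite !lift_relE => /asboolP f0 /asboolP f1.
apply/real_classP; move: f0 f1; apply: filterS2 => e f0 f1.
by apply/le_anti; rewrite f0 f1.
Qed.

Lemma lift_sub_ge0 x y : le (cst 0) (y - x) = le x y.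
Proof.
elim/real_class_ind: x => f; elim/real_class_ind: y => g.
rewrite [- _]lift1E [_ + _]lift2E !lift_relE.
by apply: asbool_equiv_eq; split; apply: filterS => e; rewrite subr_ge0.
Qed.

Lemma lift_le0_total x : le (cst 0) x || le x (cst 0).
Proof.
elim/real_class_ind: x => f; rewrite !lift_relE.
have [f0|f0] := in_ultra_setVsetC [set e | 0 <= f e] UU; apply/orP.
  by left; apply/asboolP.
by right; apply/asboolP; apply: filterS f0 => e /negP; rewrite -ltNge => /ltW.
Qed.

Lemma lift_normN x : lift1 Num.norm (- x) = lift1 Num.norm x.
Proof.
elim/real_class_ind: x => f; rewrite [- _]lift1E !lift1E.
by congr real_class; apply/funext => e; rewrite normrN.
Qed.

Lemma lift_ge0_norm x : le (cst 0) x -> lift1 Num.norm x = x.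
Proof.
elim/real_class_ind: x => f; rewrite lift_relE lift1E => /asboolP f0.
by apply/real_classP; apply: filterS f0 => e; apply: ger0_norm.
Qed.

Lemma lift_lt_def x y : lt x y = (y != x) && le x y.
Proof.
elim/real_class_ind: x => f; elim/real_class_ind: y => g; rewrite !lift_relE.
apply/asboolP/andP => [fg|[gf /asboolP fg]].
  split; last by apply/asboolP; apply: filterS fg => e /ltW.
  apply/eqP => /real_classP gf.
  (* Strict inequality and equality, both a.e., would put the empty set in [U]. *)
  suff /filter_ex[] : \forall e \near U, False by [].
  by move: fg gf; apply: filterS2 => e + gfe; rewrite gfe ltxx.
(* Maximality of [U] turns distinct classes into nets that differ a.e. *)
have [gf'|gf'] := in_ultra_setVsetC [set e | g e = f e] UU.
  by case/eqP: gf; apply/real_classP.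
move: gf' fg; apply: filterS2 => e /eqP gf' fg.
by rewrite lt_def gf'.
Qed.

HB.instance Definition _ := Num.IntegralDomain_isLeReal.Build starR
  lift_le0D lift_le0M lift_le0_anti lift_sub_ge0 lift_le0_total
  lift_normN lift_ge0_norm lift_lt_def.

(** * Agreement with the operations and order inherited from *C *)

Lemma val_star_realD (x y : starR) : \val (x + y) = star_add (\val x) (\val y).
Proof.
elim/real_class_ind: x => f; elim/real_class_ind: y => g.
rewrite [_ + _]lift2E /= star_addE; apply/star_classP.
by apply: nearW => e; rewrite rmorphD.
Qed.

Lemma val_star_realM (x y : starR) : \val (x * y) = star_mul (\val x) (\val y).
Proof.
elim/real_class_ind: x => f; elim/real_class_ind: y => g.
rewrite [_ * _]lift2E /= star_mulE; apply/star_classP.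
by apply: nearW => e; rewrite rmorphM.
Qed.

Lemma val_star_real_lt (x y : starR) : x < y <-> star_lt (\val x) (\val y).
Proof.
elim/real_class_ind: x => f; elim/real_class_ind: y => g.
rewrite [_ < _]lift_relE /= star_ltE.
by split=> [/asboolP|fg]; last apply/asboolP;
  [move=> fg|]; apply: filterS fg => e; rewrite ltcR.
Qed.

(** * Embedding of R by constant nets *)

Definition of_real (r : R) : starR := cst r.

Lemma of_real_is_zmod_morphism : zmod_morphism of_real.
Proof.
move=> r t; rewrite /of_real [- cst t]lift1E; symmetry.
exact: (lift2E +%R (fun=> r) (fun=> - t)).
Qed.

Lemma of_real_is_monoid_morphism : monoid_morphism of_real.
Proof. by split=> // r t; rewrite [RHS]lift2E. Qed.

HB.instance Definition _ :=
  GRing.isZmodMorphism.Build R starR of_real of_real_is_zmod_morphism.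
HB.instance Definition _ :=
  GRing.isMonoidMorphism.Build R starR of_real of_real_is_monoid_morphism.

Lemma ltr_of_real : {mono of_real : r t / r < t}.
Proof.
move=> r t; rewrite [LHS]lift_relE.
by apply/asboolP/idP => [/filter_ex[]|rt] //; apply: nearW.
Qed.

End StarReal.

(** Morphisms of fields commute with division, zero divisors included because both inverses of 0 are
    0; this makes the copy of R a subfield. *)
Lemma divring_closed_image (K L : fieldType) (i : {rmorphism K -> L}) :
  GRing.divring_closed [pred x : L | `[< exists r : K, x = i r >]].
Proof.
split=> [|_ _ /asboolP[r ->] /asboolP[t ->]|_ _ /asboolP[r ->] /asboolP[t ->]];
  apply/asboolP.
- by exists 1; rewrite rmorph1.
- by exists (r - t); rewrite rmorphB.
- by exists (r / t); rewrite fmorph_div.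
Qed.

Theorem theorem2p5p2 (R : realType) (U : set_system {posnum R})
    (UU : UltraFilter U)
    (U0 : forall n : nat, (0 < n)%N ->
      U [set e : {posnum R} | e%:num < n%:R^-1]) :
  (* a structure of totally ordered field on the type of elements of *R *)
  exists s : Num.RealField (starR UU),
    let F : realFieldType := Num.RealField.Pack s in
    let v : F -> starC UU := fun x => \val (x : starR UU) in
    (* (a) its operations and order are those of *R *)
    [/\ v 0 = star_cst UU 0, v 1 = star_cst UU 1,
        forall x y : F, v (x + y) = star_add (v x) (v y),
        forall x y : F, v (x * y) = star_mul (v x) (v y)
      & forall x y : F, (x < y) <-> star_lt (v x) (v y)] /\
    (* (b) the identification of R with the constant classes *)
    exists i : {rmorphism R -> F},
      [/\ forall r : R, v (i r) = star_cst UU r%:C,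
          injective i,
          {mono i : r t / r < t}
        & GRing.divring_closed [pred x : F | `[< exists r : R, x = i r >]]].
Proof.
(* The alias [star_real] unfolds to the type of elements of *R, so the instances built on it supply
   the structure. *)
exists (Num.RealField.class (star_real R U UU)) => F v; split.
  split=> //.
  - exact: val_star_realD.
  - exact: val_star_realM.
  - exact: val_star_real_lt.
exists (of_real R U UU : {rmorphism R -> star_real R U UU}); split=> //.
- exact: fmorph_inj.
- exact: ltr_of_real.
- exact: (divring_closed_image R (star_real R U UU)).
Qed.
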